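(* Let $X$ be a Banach space which is weak MLUR. If $X$ has the local diameter 2 property (LD2P), then $X$ has the diameter 2 property (D2P).
   Context: Banach spaces are over the real scalars. $B_X$ and $S_X$ denote the closed unit ball and the unit sphere of a Banach space $X$. $X$ is weak midpoint locally uniformly rotund (weak MLUR) if for every $x\in S_X$ and every sequence $(x_n)$ in $X$ with $\|x+x_n\|\to 1$ and $\|x-x_n\|\to 1$ one has $x_n\to 0$ weakly. A slice of $B_X$ is a set of the form $S(x^*,\varepsilon)=\{x\in B_X: x^*(x)>1-\varepsilon\}$, where $x^*\in S_{X^*}$ and $\varepsilon>0$. $X$ has the LD2P if every slice of $B_X$ has diameter $2$. $X$ has the D2P if every non-empty relatively weakly open subset of $B_X$ has diameter $2$. *)

(* Defs.v *)
From HB Require Import structures.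
From mathcomp Require Import all_boot all_order all_algebra.
From mathcomp Require Import all_classical all_reals all_analysis.

Set Implicit Arguments.
Unset Strict Implicit.
Unset Printing Implicit Defensive.

Import Order.TTheory GRing.Theory Num.Theory.
Import numFieldNormedType.Exports.

Local Open Scope classical_set_scope.
Local Open Scope ring_scope.

Definition unit_ball {R : realType} (X : normedModType R) : set X :=
  [set x | `|x| <= 1].
Arguments unit_ball {R} X.

Definition unit_sphere {R : realType} (X : normedModType R) : set X :=
  [set x | `|x| = 1].
Arguments unit_sphere {R} X.

(* [-oo] on the empty set; the values are extended reals so that unbounded
   sets have diameter [+oo]. *)
Definition diameter {R : realType} {X : normedModType R} (A : set X) : \bar R :=
  ereal_sup [set (`|x - y|)%:E | x in A & y in A].

(* The topological dual X^*, as a set of linear forms (only the carrier is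
   needed here, together with its norm). *)
Record dual {R : realType} (X : normedModType R) := Dual {
  dual_fun :> {linear X -> R^o};
  dual_continuous : continuous dual_fun }.

(* The set is nonempty and bounded because [f] is continuous, so this real
   supremum is the operator norm. *)
Definition dual_norm {R : realType} {X : normedModType R} (f : dual X) : R :=
  sup [set `|f x : R| | x in unit_ball X].

Definition dual_sphere {R : realType} (X : normedModType R) : set (dual X) :=
  [set f | dual_norm f = 1].
Arguments dual_sphere {R} X.

(* [weak X] is [X] with the coarsest topology making every element of [dual X]
   continuous; it is convertible to [X], and the type ascription selects the
   topology. *)
Definition weak {R : realType} (X : normedModType R) : topologicalType :=
  sup_topology (fun f : dual X =>
    Topological.on (initial_topology (fun x : X => f x : R))).

Definition weakMLUR {R : realType} (X : normedModType R) : Prop :=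
  forall x : X, unit_sphere X x ->
  forall u : nat -> X,
    (fun n => `|x + u n|) @ \oo --> (1 : R) ->
    (fun n => `|x - u n|) @ \oo --> (1 : R) ->
    (u : nat -> weak X) @ \oo --> ((0 : X) : weak X).

Definition slice {R : realType} {X : normedModType R} (f : dual X) (e : R) :
  set X := [set x | unit_ball X x /\ f x > 1 - e].

Definition LD2P {R : realType} (X : normedModType R) : Prop :=
  forall (f : dual X) (e : R), dual_sphere X f -> 0 < e ->
    diameter (slice f e) = 2%:E.

Definition D2P {R : realType} (X : normedModType R) : Prop :=
  forall U : set (weak X), open U -> unit_ball X `&` (U : set X) !=set0 ->
    diameter (unit_ball X `&` (U : set X)) = 2%:E.

(* Main.v *)
Require Import Defs.
From HB Require Import structures.
From mathcomp Require Import all_boot all_order all_algebra.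
From mathcomp Require Import all_classical all_reals all_analysis.
From mathcomp Require Import ring lra.

Import Order.TTheory GRing.Theory Num.Theory.
Import numFieldNormedType.Exports.

Local Open Scope classical_set_scope.
Local Open Scope ring_scope.

Set Implicit Arguments.
Unset Strict Implicit.

(** A weakly open set meeting the unit ball is shown to contain a slice, which
    has diameter 2 by the LD2P.

    The main step is [slice_near_abs]: if [X] is weak MLUR and [x] is a unit
    vector, then every weak neighbourhood of [x] contains a slice of the unit
    ball.  This is classically read off in the bidual: [x] is an extreme point
    of the unit ball of [X^**], and Choquet's lemma applies.  The argument here
    stays in [X].  The points [y] of the ball outside the neighbourhood form a
    finite union of convex sets [K_i], each cut out by one functional.  If [x]
    were a norm limit of convex combinations [\sum_i l_i y_i] with [y_i] in
    [K_i], some weight [l_j] would be at least the average [t = 1 / #|I|], and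
    then [u = t (y_j - x)] would make both [|x + u|] and [|x - u|] almost at
    most 1.  Weak MLUR makes such [u] weakly small, uniformly for finitely many
    functionals ([weakMLUR_uniform_fin]), whereas [y_j] stays away from [x] in
    the direction of the [j]-th functional.  So [x] has positive distance to
    the convex hull of the [K_i] ([cone_gap]), and a Hahn-Banach functional
    separating the two defines the slice ([slice_near]).

    It remains to move from a point of the ball to a point of the sphere.  If
    finitely many functionals [f_i] had no common nonzero kernel vector, then
    [v = \sum_i f_i(v) e_i] for suitable [e_i] ([coordinate_system]), so small
    weak neighbourhoods would have small diameter, although they contain
    slices ([exists_common_kernel]).  Hence a weak neighbourhood of a point [x]
    contains a whole line through [x], which meets the sphere when [x] lies in
    the ball.

    The Hahn-Banach theorem is proved in the form needed here
    ([hahn_banach_cone]), by noting that a minimal sublinear functional is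
    linear. *)

(** * Sublinear functionals and a Hahn-Banach theorem for cones *)

(** Homogeneity is only required as an inequality, for nonnegative factors;
    the equality follows. *)
Definition sublinear (R : realType) (X : lmodType R) (q : X -> R) : Prop :=
  (forall u v, q (u + v) <= q u + q v) /\
  (forall t u, 0 <= t -> q (t *: u) <= t * q u).

(** A pair [(w, c)] of the cone stands for the constraint [c <= f w] on a
    linear form [f]. *)
Definition convex_cone (R : realType) (X : lmodType R)
    (C : set (X * R)) : Prop :=
  [/\ C (0, 0),
      (forall p1 p2, C p1 -> C p2 -> C (p1.1 + p2.1, p1.2 + p2.2)) &
      (forall t p, 0 < t -> C p -> C (t *: p.1, t * p.2))].

Lemma convex_cone_ray (R : realType) (X : lmodType R) (w : X) (c : R) :
  convex_cone [set (t *: w, t * c) | t in [set t : R | 0 <= t]].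
Proof.
split.
- by exists 0 => //=; rewrite scale0r mul0r.
- move=> _ _ [s /= s0 <-] [t /= t0 <-]; exists (s + t); first exact: addr_ge0.
  by rewrite scalerDl mulrDl.
- move=> t _ t0 [s /= s0 <-]; exists (t * s); last by rewrite scalerA mulrA.
  exact: mulr_ge0 (ltW t0) s0.
Qed.

(** For a cone [C] of pairs with [c <= q w], the largest sublinear functional
    [r <= q] such that [r (- w) <= - c] for all [(w, c)] in [C]; a linear form
    below it satisfies all the constraints of [C]. *)
Definition relax (R : realType) (X : lmodType R) (q : X -> R)
    (C : set (X * R)) (u : X) : R :=
  inf [set q (u + p.1) - p.2 | p in C].

Lemma sublinear0 (R : realType) (X : lmodType R) (q : X -> R) :
  sublinear q -> q 0 = 0.
Proof.
move=> [qD qZ]; have := qD 0 0; have := qZ 0 0 (lexx _).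
rewrite scale0r mul0r addr0; lra.
Qed.

Section Relax.
Variables (R : realType) (X : lmodType R) (q : X -> R) (C : set (X * R)).
Hypotheses (q_sub : sublinear q) (C_cone : convex_cone C).
Hypothesis C_le : forall p, C p -> p.2 <= q p.1.

Lemma relax_le u p : C p -> relax q C u <= q (u + p.1) - p.2.
Proof.
move=> Cp; apply: ge_inf; last by exists p.
exists (- q (- u)) => _ [s Cs <-].
have := C_le Cs; have := q_sub.1 (- u) (u + s.1).
by rewrite addrA addNr add0r; lra.
Qed.

Lemma le_relax u c :
  (forall p, C p -> c <= q (u + p.1) - p.2) -> c <= relax q C u.
Proof.
move=> h; have [C0 _ _] := C_cone; apply: lb_le_inf.
  by exists (q (u + 0) - 0); exists (0, 0).
by move=> _ [p Cp <-]; exact: h.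
Qed.

Lemma relax_sublinear : sublinear (relax q C).
Proof.
have [C0 CD CZ] := C_cone; split=> [u v|t u].
  rewrite -lerBlDl; apply: le_relax => p Cp.
  rewrite lerBlDl -lerBlDr; apply: le_relax => s Cs.
  have := relax_le (u + v) (CD _ _ Cs Cp); rewrite /= addrACA.
  by have := q_sub.1 (u + s.1) (v + p.1); lra.
rewrite le_eqVlt => /predU1P[<-|t0].
  rewrite scale0r mul0r; have := relax_le 0 C0.
  by rewrite addr0 subr0 (sublinear0 q_sub).
rewrite -ler_pdivrMl//; apply: le_relax => p Cp; rewrite ler_pdivrMl//.
apply: le_trans (relax_le _ (CZ _ _ t0 Cp)) _ => /=.
by rewrite -scalerDr mulrBr lerB// q_sub.2// ltW.
Qed.

End Relax.

(** By Zorn's lemma: the pointwise infimum of a nonempty chain of sublinear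
    functionals below [p] is finite, because [- p (- u) <= q u] for each of
    them. *)
Lemma exists_minimal_sublinear (R : realType) (X : lmodType R) (p : X -> R) :
  sublinear p -> exists q : X -> R,
    [/\ sublinear q, (forall u, q u <= p u) &
        forall q' : X -> R, sublinear q' -> (forall u, q' u <= q u) ->
        forall u, q u <= q' u].
Proof.
move=> p_sub.
pose T := {q : X -> R | sublinear q /\ forall u, q u <= p u}.
pose ge (q1 q2 : T) := `[< forall u, sval q2 u <= sval q1 u >].
have geP q1 q2 : reflect (forall u, sval q2 u <= sval q1 u) (ge q1 q2).
  exact: asboolP.
pose pT : T := exist _ p (conj p_sub (fun=> lexx _)).
have [|||[q [q_sub qp]] qmin] := @ZL_preorder T pT ge.
- by move=> q; apply/geP.
- move=> q2 q1 q3 /geP h /geP h'; apply/geP => u.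
  exact: le_trans (h' u) (h u).
- move=> A Atot; have [->|/set0P[q0 Aq0]] := eqVneq A set0.
    by exists pT.
  pose m u := inf [set sval q u | q in A].
  have m_lb (q : T) u : - p (- u) <= sval q u.
    case: q => q [q_sub qp] /=.
    have := qp (- u); have := q_sub.1 u (- u).
    by rewrite subrr (sublinear0 q_sub); lra.
  have m_le q u : A q -> m u <= sval q u.
    move=> Aq; apply: ge_inf; last by exists q.
    by exists (- p (- u)) => _ [s As <-].
  have le_m c u : (forall q, A q -> c <= sval q u) -> c <= m u.
    move=> h; apply: lb_le_inf; first by exists (sval q0 u); exists q0.
    by move=> _ [q Aq <-]; exact: h.
  have m_sub : sublinear m.
    split=> [u v|t u].
      rewrite -lerBlDl; apply/le_m => q Aq.
      rewrite lerBlDl -lerBlDr; apply/le_m => s As.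
      (* the smaller of [q] and [s] bounds both terms *)
      have [r [Ar rq rs]] : exists r : T,
          [/\ A r, sval r v <= sval q v & sval r u <= sval s u].
        by have [/geP h|/geP h] := Atot _ _ Aq As; [exists s|exists q].
      have := m_le _ (u + v) Ar; have := (svalP r).1.1 u v; lra.
    rewrite le_eqVlt => /predU1P[<-|t0].
      rewrite scale0r mul0r -[leRHS](sublinear0 (svalP q0).1).
      exact: m_le Aq0.
    rewrite -ler_pdivrMl//; apply/le_m => q Aq; rewrite ler_pdivrMl//.
    apply: le_trans (m_le _ _ Aq) _; exact: (svalP q).1.2 (ltW t0).
  have mp u : m u <= p u by exact: le_trans (m_le _ _ Aq0) ((svalP q0).2 u).
  exists (exist _ m (conj m_sub mp)) => q Aq; apply/geP => u; exact: m_le.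
- exists q; split=> // q' q'_sub q'q.
  have q'p u : q' u <= p u by exact: le_trans (q'q u) (qp u).
  pose q'T : T := exist _ q' (conj q'_sub q'p).
  by have /geP : ge q'T (exist _ q (conj q_sub qp)) by apply: qmin; apply/geP.
Qed.

(** Relaxing [q] along the ray of the constraints [t * q v <= f (t *: v)] gives
    back [q] by minimality, whence [q (- v) <= - q v]; an odd sublinear
    functional is linear. *)
Lemma minimal_sublinear_linear (R : realType) (X : lmodType R) (q : X -> R) :
  sublinear q ->
  (forall q' : X -> R, sublinear q' -> (forall u, q' u <= q u) ->
     forall u, q u <= q' u) ->
  linear (q : X -> R^o).
Proof.
move=> q_sub qmin; have [qD qZ] := q_sub.
have qN v : q (- v) = - q v.
  apply/le_anti/andP; split; last first.
    by have := qD v (- v); rewrite subrr (sublinear0 q_sub); lra.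
  pose C := [set (t *: v, t * q v) | t in [set t : R | 0 <= t]].
  have C_cone : convex_cone C by exact: convex_cone_ray.
  have C_le p : C p -> p.2 <= q p.1.
    move=> [t /= + <-] /=; rewrite le_eqVlt => /predU1P[<-|t0].
      by rewrite mul0r scale0r (sublinear0 q_sub).
    rewrite mulrC -ler_pdivlMr// mulrC.
    have ti : 0 <= t^-1 by rewrite invr_ge0 ltW.
    have := qZ t^-1 (t *: v) ti.
    by rewrite scalerA mulVf ?gt_eqF// scale1r.
  have C1 : C (v, q v) by exists 1 => /=; [exact: ler01|rewrite scale1r mul1r].
  have := relax_le q_sub C_le (- v) C1.
  rewrite /= addNr (sublinear0 q_sub) sub0r.
  apply: le_trans; apply: qmin (relax_sublinear q_sub C_cone C_le) _ _ => u.
  have [C0 _ _] := C_cone.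
  by have := relax_le q_sub C_le u C0; rewrite /= addr0 subr0.
have qDE u v : q (u + v) = q u + q v.
  apply/le_anti; rewrite qD /=; have := qD (u + v) (- v).
  by rewrite addrK qN; lra.
have qZp t u : 0 <= t -> q (t *: u) = t * q u.
  move=> t0; apply/le_anti; rewrite qZ//=; have := qZ t (- u) t0.
  by rewrite scalerN !qN mulrN lerN2.
move=> t u v; rewrite qDE; congr (_ + _).
have [t0|t0] := lerP 0 t; first exact: qZp.
by rewrite -[t]opprK scaleNr qN qZp ?oppr_ge0 ?ltW// scaleNr.
Qed.

(** A cone of constraints [c <= f w] is satisfied by some functional of norm at
    most 1 as soon as [c <= |w|] for each of them. *)
Lemma hahn_banach_cone (R : realType) (X : normedModType R) (C : set (X * R)) :
  convex_cone C -> (forall p, C p -> p.2 <= `|p.1|) ->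
  exists f : dual X, (forall u, f u <= `|u|) /\ (forall p, C p -> p.2 <= f p.1).
Proof.
move=> C_cone C_le.
have n_sub : sublinear (fun u : X => `|u|).
  by split=> [u v|t u t0]; [exact: ler_normD|rewrite normrZ ger0_norm].
have [q [q_sub qle qmin]] := exists_minimal_sublinear
  (relax_sublinear n_sub C_cone C_le).
have qlin := minimal_sublinear_linear q_sub qmin.
pose f : {linear X -> R^o} :=
  HB.pack (q : X -> R^o) (GRing.isLinear.Build _ _ _ _ _ qlin).
have f_le u : f u <= `|u|.
  have [C0 _ _] := C_cone; apply: le_trans (qle u) _.
  by have := relax_le n_sub C_le u C0; rewrite /= addr0 subr0.
have f_cont : continuous f.
  apply/linear_bounded_continuous/linear_boundedP; near=> M => u.
  apply: (@le_trans _ _ `|u|).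
    rewrite ler_norml f_le andbT lerNl -(linearN f).
    by apply: le_trans (f_le _) _; rewrite normrN.
  by apply: ler_peMl => //; near: M; exact: nbhs_pinfty_ge.
exists (@Dual _ _ f f_cont); split=> // p Cp.
have := qle (- p.1); rewrite -[q _]/(f _) linearN.
have := relax_le n_sub C_le (- p.1) Cp; rewrite /= addNr normr0; lra.
Unshelve. all: by end_near.
Qed.

(** * Functionals of norm one and their slices *)

Lemma dual_normr_le (R : realType) (X : normedModType R) (f : dual X) :
  (forall u, f u <= `|u|) -> forall u, `|f u : R| <= `|u|.
Proof.
move=> fle u; rewrite ler_norml fle andbT lerNl -linearN.
by rewrite (le_trans (fle _))// normrN.
Qed.

Lemma scale_dual_continuous (R : realType) (X : normedModType R) (a : R)
  (f : dual X) : continuous (a \*: f : X -> R^o).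
Proof. by move=> x; apply: cvgZr; exact: dual_continuous. Qed.

(** The multiple [a f] of a functional, as an element of the dual. *)
Definition scale_dual (R : realType) (X : normedModType R) (a : R)
  (f : dual X) : dual X := Dual (@scale_dual_continuous R X a f).

Lemma le_dual_norm (R : realType) (X : normedModType R) (f : dual X) (y : X) :
  `|y| <= 1 -> `|f y : R| <= dual_norm f.
Proof.
move=> y1; apply: ub_le_sup; last by exists y.
have /linear_boundedP fb :=
  @continuous_linear_bounded _ _ _ 0 f (@dual_continuous _ _ f 0).
near +oo_R => M.
exists M => _ [z z1 <-]; apply: (@le_trans _ _ (M * `|z|)).
  by move: z {z1}; near: M.
by rewrite ler_piMr.
Unshelve. all: by end_near. Qed.

Lemma dual_norm_le (R : realType) (X : normedModType R) (f : dual X) (M : R) :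
  (forall y, `|y| <= 1 -> `|f y : R| <= M) -> dual_norm f <= M.
Proof.
move=> fM; apply: ge_sup; last by move=> _ [y y1 <-]; exact: fM.
by exists `|f 0 : R|, 0 => //; rewrite /unit_ball /= normr0.
Qed.

Lemma scale_dual_sphere (R : realType) (X : normedModType R) (f : dual X) :
  0 < dual_norm f -> dual_sphere X (scale_dual (dual_norm f)^-1 f).
Proof.
move=> f0; apply/le_anti/andP; split.
  apply: dual_norm_le => y y1 /=; rewrite normrM gtr0_norm ?invr_gt0//.
  by rewrite ler_pdivrMl// mulr1 le_dual_norm.
rewrite -(ler_pM2l f0) mulr1; apply: dual_norm_le => y y1.
rewrite -ler_pdivrMl//.
have := @le_dual_norm _ _ (scale_dual (dual_norm f)^-1 f) _ y1.
by rewrite /= normrM gtr0_norm ?invr_gt0.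
Qed.

Lemma dual_norm_gt0 (R : realType) (X : normedModType R) (f : dual X) (u : X) :
  f u != 0 -> 0 < dual_norm f.
Proof.
move=> fu0; have u0 : 0 < `|u|.
  by rewrite normr_gt0; apply: contra_neq fu0 => ->; rewrite linear0.
have u1 : `| `|u|^-1 *: u | <= 1.
  by rewrite normrZ gtr0_norm ?invr_gt0// mulVf// gt_eqF.
apply: lt_le_trans (le_dual_norm f u1).
by rewrite linearZ normr_gt0 mulf_neq0// invr_eq0 gt_eqF.
Qed.

(** Normalizing [f] divides the depth of a cap by [dual_norm f <= 1], so the
    slice of depth [r] of the normalized functional lies in the cap of depth
    [r] of [f]. *)
Lemma slice_sub_halfspace (R : realType) (X : normedModType R) (f : dual X)
    (u : X) (r : R) : (forall v, f v <= `|v|) -> f u != 0 -> 0 < r ->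
  exists2 F : dual X, dual_sphere X F &
    slice F r `<=` [set y | unit_ball X y /\ f y > dual_norm f - r].
Proof.
move=> fle fu r0; have s0 := dual_norm_gt0 fu.
have s1 : dual_norm f <= 1.
  by apply: dual_norm_le => y; apply: le_trans; exact: dual_normr_le.
exists (scale_dual (dual_norm f)^-1 f); first exact: scale_dual_sphere.
move=> y [y1 /=]; rewrite -[_ *: _]/(_ * _) ltr_pdivlMl// => fy; split=> //.
apply: le_lt_trans fy; rewrite mulrBr mulr1 lerB//.
by rewrite ler_piMl// ltW.
Qed.

(** The cone consists of the multiples of the constraint [`|x| <= f x]. *)
Lemma exists_dual_sphere (R : realType) (X : normedModType R) (x : X) :
  x != 0 -> exists F : dual X, dual_sphere X F.
Proof.
move=> x0.
pose C := [set (t *: x, t * `|x|) | t in [set t : R | 0 <= t]].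
have C_cone : convex_cone C by exact: convex_cone_ray.
have [|f [fle fC]] := hahn_banach_cone C_cone.
  by move=> _ [t /= t0 <-] /=; rewrite normrZ ger0_norm.
have fx : f x != 0.
  rewrite gt_eqF//; apply: lt_le_trans (fC (x, `|x|) _).
    by rewrite normr_gt0.
  by exists 1 => /=; [exact: ler01|rewrite scale1r mul1r].
have [F F1 _] := slice_sub_halfspace fle fx (@ltr01 R).
by exists F.
Qed.

(** * Uniform forms of weak midpoint local uniform rotundity *)

Lemma weak_continuous (R : realType) (X : normedModType R) (f : dual X) :
  continuous (f : weak X -> R).
Proof.
move=> x; have /cvg_sup/(_ f) := @cvg_id (weak X) (nbhs x).
move=> h; apply: cvg_trans (@initial_continuous _ _ (f : X -> R) x).
by apply: cvg_app; exact: h.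
Qed.

Lemma weakMLUR_uniform (R : realType) (X : normedModType R) (x : X)
    (f : dual X) (eta : R) :
  weakMLUR X -> unit_sphere X x -> 0 < eta ->
  exists2 eps : R, 0 < eps &
    forall u, `|x + u| <= 1 + eps -> `|x - u| <= 1 + eps -> f u < eta.
Proof.
move=> mlur x1 eta0; apply: contrapT => /forall2NP noeps.
have /choice[u uP] (n : nat) : exists u, [/\ `|x + u| <= 1 + n.+1%:R^-1,
    `|x - u| <= 1 + n.+1%:R^-1 & eta <= f u].
  have [|] := noeps n.+1%:R^-1; first by rewrite invr_gt0 ltr0Sn.
  move=> /existsNP[u] /not_implyP[h1] /not_implyP[h2] /negP.
  by rewrite -leNgt => h3; exists u.
(* [x + u n] and [x - u n] add up to [2 x], so neither norm can be small *)
have lb n : 2 <= `|x + u n| + `|x - u n|.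
  apply: le_trans (ler_normD _ _); rewrite addrACA subrr addr0 -mulr2n normrMn.
  by rewrite x1.
have cvg1 (s : R) : (fun n => 1 + s * n.+1%:R^-1) @ \oo --> (1 : R).
  rewrite -[X in _ --> X]addr0; apply: cvgD; first exact: cvg_cst.
  rewrite -(mulr0 s); apply: cvgM; [exact: cvg_cst|exact: cvg_harmonic].
have cvgx (v : nat -> X) :
    (forall n, 1 - n.+1%:R^-1 <= `|x + v n| <= 1 + n.+1%:R^-1) ->
    (fun n => `|x + v n|) @ \oo --> (1 : R).
  move=> h; apply: squeeze_cvgr (cvg1 (-1)) (cvg1 1).
  by near=> n; rewrite mulN1r mul1r; exact: h.
have u0 : (u : nat -> weak X) @ \oo --> ((0 : X) : weak X).
  apply: mlur x1 _ _ _; [apply: cvgx|apply: (cvgx (fun n => - u n))] => n.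
  - have [h1 h2 _] := uP n; have := lb n; rewrite h1 andbT.
    by move: `|x + u n| `|x - u n| n.+1%:R^-1 h1 h2 => a b e; lra.
  - have [h1 h2 _] := uP n; have := lb n; rewrite h2 andbT.
    by move: `|x + u n| `|x - u n| n.+1%:R^-1 h1 h2 => a b e; lra.
have : (fun n => f (u n) : R) @ \oo --> (f 0 : R).
  exact: cvg_comp u0 (@weak_continuous _ _ f 0).
rewrite linear0 => /cvgrPdist_lt /(_ _ eta0) [N _ /(_ N (leqnn N))].
rewrite /= sub0r normrN => /(le_lt_trans (ler_norm _)).
by have [_ _] := uP N; rewrite leNgt => /negP.
Unshelve. all: by end_near. Qed.

Lemma weakMLUR_uniform_fin (R : realType) (X : normedModType R) (x : X)
    (I : finType) (g : I -> dual X) (eta : R) :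
  weakMLUR X -> unit_sphere X x -> 0 < eta ->
  exists2 eps : R, 0 < eps & forall u,
    `|x + u| <= 1 + eps -> `|x - u| <= 1 + eps -> forall i, g i u < eta.
Proof.
move=> mlur x1 eta0.
have /choice[e eP] (i : I) : exists e : R, 0 < e /\
    forall u, `|x + u| <= 1 + e -> `|x - u| <= 1 + e -> g i u < eta.
  by have [e e0 h] := weakMLUR_uniform (g i) mlur x1 eta0; exists e.
exists (\big[Order.min/1]_i e i).
  by apply: lt_bigmin => // i _; exact: (eP i).1.
move=> u h1 h2 i; apply: (eP i).2.
- by apply: le_trans h1 _; rewrite lerD2l; exact: bigmin_le.
- by apply: le_trans h2 _; rewrite lerD2l; exact: bigmin_le.
Qed.

(** * Slices near a point of the sphere *)

Lemma ex_ge_average (R : realFieldType) (I : finType) (l : I -> R) :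
  0 < \sum_i l i -> exists j, #|I|%:R^-1 * \sum_i l i <= l j.
Proof.
move=> L0; apply: contrapT => /forallNP small.
have I0 : (0 < #|I|)%N.
  rewrite lt0n; apply/negP => /eqP/card0_eq I0; move: L0.
  by rewrite big_pred0 ?ltxx// => i; have := I0 i; rewrite inE.
have /card_gt0P[i0 _] := I0.
have : \sum_i l i < \sum_(i in I) #|I|%:R^-1 * \sum_i l i.
  apply: ltr_sum; first by apply/hasP; exists i0; rewrite ?mem_index_enum.
  by move=> i _; rewrite ltNge; exact/negP/small.
by rewrite sumr_const -[ltRHS]mulr_natl mulVKf ?ltxx// pnatr_eq0 -lt0n.
Qed.

(** Homogeneous form, with weights [l i] and with [v i] standing for
    [l i *: y i], of the statement that [x] is at distance at least [eps / 2]
    from the convex hull of the sets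
    [K_i = {y : |y| <= 1, g_i x + delta <= g_i y}].  Writing it with [v i]
    makes the data a convex cone and admits empty [K_i], for which
    [l i = 0]. *)
Lemma cone_gap (R : realType) (X : normedModType R) (x : X) (I : finType)
    (g : I -> dual X) (delta eps : R) (l : I -> R) (v : I -> X) :
  unit_sphere X x -> 0 < eps ->
  (forall u, `|x + u| <= 1 + eps -> `|x - u| <= 1 + eps ->
     forall i, g i u < #|I|%:R^-1 * delta) ->
  (forall i, `|v i| <= l i) -> (forall i, (g i x + delta) * l i <= g i (v i)) ->
  eps / 2 * (\sum_i l i) <= `|(\sum_i l i) *: x - \sum_i v i|.
Proof.
rewrite /unit_sphere /= => x1 eps0 H vl gv; rewrite leNgt; apply/negP.
set L := \sum_i l i; set w := \sum_i v i => gap.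
have L0 : 0 < L.
  by rewrite -(pmulr_rgt0 _ (divr_gt0 eps0 (@ltr0Sn R 1))) (le_lt_trans _ gap).
(* [y = v j / l j] is the point of [K_j] with a weight of at least average
   size *)
have [j Lj] := ex_ge_average L0.
have I0 : (0 < #|I|)%N by apply/card_gt0P; exists j.
have t0 : 0 < #|I|%:R^-1 :> R by rewrite invr_gt0 ltr0n.
have t1 : #|I|%:R^-1 <= 1 :> R by rewrite invf_le1 ?ler1n ?ltr0n.
move: (#|I|%:R^-1 : R) t0 t1 Lj H => t t0 t1; rewrite -/L => Lj H.
have lj0 : 0 < l j by apply: lt_le_trans Lj; exact: mulr_gt0.
pose u := t *: ((l j)^-1 *: v j - x).
have : g j u < t * delta.
  apply: H.
  - have -> : x + u = (1 - t) *: x + (t / l j) *: v j.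
      by rewrite /u scalerBr scalerA scalerBl scale1r addrA addrAC.
    apply: le_trans (ler_normD _ _) _.
    rewrite (normrZ (1 - t)) (normrZ (t / l j)) x1 mulr1.
    rewrite ger0_norm ?subr_ge0// gtr0_norm ?divr_gt0//.
    apply: (@le_trans _ _ 1); last by rewrite lerDl ltW.
    rewrite -lerBrDl subKr.
    by rewrite -mulrA ler_piMr ?(ltW t0)// ler_pdivrMl// mulr1.
  - pose c := 1 + t - t * L / l j.
    have c0 : 0 <= c.
      suff : t * L / l j <= 1 by rewrite /c; lra.
      by rewrite ler_pdivrMr// mul1r.
    (* [x - u] is, up to a multiple of the gap [L *: x - w], a convex
       combination of the points [v i / l i] *)
    have eqL : L *: (x - u) =
        (1 + t) *: (L *: x - w) + (1 + t) *: (w - v j) + c *: v j.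
      have -> : x - u = (1 + t) *: x - (t / l j) *: v j.
        by rewrite /u scalerBr scalerA opprB scalerDl scale1r addrA.
      rewrite -scalerDr addrA subrK !scalerBr !scalerA -addrA -!scaleNr.
      rewrite -scalerDl; congr (_ *: _ + _ *: _); rewrite /c /GRing.scale/=.
        by field.
      by field; rewrite gt_eqF.
    have t1p : 0 <= 1 + t by rewrite addr_ge0// ltW.
    have nw : `|w - v j| <= L - l j.
      rewrite /w /L (bigD1 j)//= [X in _ <= X - _](bigD1 j)//=.
      rewrite ![_ j + _]addrC !addrK.
      apply: le_trans (ler_norm_sum _ _ _) _; exact: ler_sum.
    rewrite -(ler_pM2l L0) -[X in X * `|_|](gtr0_norm L0) -normrZ eqL.
    apply: le_trans (ler_normD _ _) _.
    have h1 : `|c *: v j| <= (1 + t) * l j - t * L.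
      rewrite normrZ ger0_norm//; apply: le_trans (ler_wpM2l c0 (vl j)) _.
      by rewrite /c mulrBl divfK ?gt_eqF.
    have h2 : `|(1 + t) *: (w - v j)| <= (1 + t) * (L - l j).
      by rewrite (normrZ (1 + t)) ger0_norm// ler_wpM2l.
    have h3 : `|(1 + t) *: (L *: x - w)| <= 2 * (eps / 2 * L).
      rewrite (normrZ (1 + t)) ger0_norm//.
      apply: ler_pM => //; last exact: ltW.
      by rewrite -[2]/(1 + 1) lerD2l.
    have := ler_normD ((1 + t) *: (L *: x - w)) ((1 + t) *: (w - v j)).
    move: `|_ + _| `|c *: _| h1 `|_ *: (w - _)| h2 `|(1 + t) *: _| h3.
    move=> a b h1 a' h2 a'' h3 h4.
    apply: (@le_trans _ _ (2 * (eps / 2 * L) + (1 + t) * (L - l j) +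
                           ((1 + t) * l j - t * L))); first lra.
    by rewrite le_eqVlt; apply/orP; left; apply/eqP; field.
apply/negP; rewrite -leNgt /u linearZ/= ler_wpM2l ?(ltW t0)// linearB linearZ/=.
rewrite lerBrDr addrC.
by rewrite -[_ *: _]/(_ * _) ler_pdivlMl// mulrC.
Qed.

(** One-sided form of [slice_near_abs]. *)
Lemma slice_near (R : realType) (X : normedModType R) (x : X) (I : finType)
    (g : I -> dual X) (delta : R) :
  weakMLUR X -> unit_sphere X x -> 0 < delta ->
  exists (F : dual X) (e : R), [/\ dual_sphere X F, 0 < e &
    forall y, slice F e y -> forall i, g i y < g i x + delta].
Proof.
move=> mlur x1 delta0.
have [I0|I0] := posnP #|I|.
  have [|F F1] := @exists_dual_sphere R X x.
    by rewrite -normr_gt0 x1.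
  by exists F, 1; split=> // y _ i; have := card0_eq I0 i; rewrite inE.
have t0 : 0 < #|I|%:R^-1 :> R by rewrite invr_gt0 ltr0n.
have [eps eps0 H] := weakMLUR_uniform_fin g mlur x1 (mulr_gt0 t0 delta0).
pose C : set (X * R) := [set p | exists (l : I -> R) (v : I -> X),
  [/\ forall i, `|v i| <= l i, forall i, (g i x + delta) * l i <= g i (v i),
      p.1 = (\sum_i l i) *: x - \sum_i v i & p.2 = eps / 2 * \sum_i l i]].
have C_cone : convex_cone C.
  split.
  - exists (fun=> 0), (fun=> 0); split=> [i|i||] /=.
    + by rewrite normr0.
    + by rewrite mulr0 linear0.
    + by rewrite !big1// scale0r subr0.
    + by rewrite big1// mulr0.
  - move=> p1 p2 [l1 [v1 [vl1 gv1 -> ->]]] [l2 [v2 [vl2 gv2 -> ->]]].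
    exists (fun i => l1 i + l2 i), (fun i => v1 i + v2 i); split=> [i|i||] /=.
    + exact: le_trans (ler_normD _ _) (lerD (vl1 i) (vl2 i)).
    + by rewrite mulrDr linearD lerD.
    + by rewrite !big_split/= scalerDl opprD addrACA.
    + by rewrite big_split mulrDr.
  - move=> t p t_gt0 [l [v [vl gv -> ->]]].
    exists (fun i => t * l i), (fun i => t *: v i); split=> [i|i||] /=.
    + by rewrite normrZ gtr0_norm// ler_pM2l.
    + by rewrite mulrCA linearZ ler_pM2l.
    + by rewrite -mulr_sumr -scaler_sumr scalerBr scalerA.
    + by rewrite -mulr_sumr mulrCA.
have [|f [fle fC]] := hahn_banach_cone C_cone.
  move=> p [l [v [vl gv -> ->]]]; exact: cone_gap H vl gv.
(* constraint of the cone carried by a single point of [K_j] *)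
have far y j : `|y| <= 1 -> g j x + delta <= g j y -> eps / 2 <= f (x - y).
  move=> y1 gy; apply: (fC (x - y, eps / 2)).
  exists (fun i => (i == j)%:R), (fun i => (i == j)%:R *: y).
  split=> [i|i||] /=.
  + by case: eqP => _; rewrite ?scale1r ?scale0r ?normr0.
  + by case: eqP => [->|_]; rewrite ?scale1r ?scale0r ?linear0 ?mulr1 ?mulr0.
  + rewrite -scaler_suml (bigD1 j)//= big1 ?addr0 ?eqxx ?scale1r//.
    by move=> i /negPf ->.
  + by rewrite (bigD1 j)//= big1 ?addr0 ?eqxx ?mulr1// => i /negPf ->.
(* If every [K_i] is empty then [f] may vanish, but any slice will do. *)
have [[[y j] [/= y1 gy]]|none] :=
    pselect (exists p : X * I, `|p.1| <= 1 /\ g p.2 x + delta <= g p.2 p.1).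
  have e0 : 0 < eps / 2 by exact: divr_gt0.
  have fxy : f (x - y) != 0 by rewrite gt_eqF// (lt_le_trans e0)// (far _ j).
  have [F F1 Fsub] := slice_sub_halfspace fle fxy e0.
  exists F, (eps / 2); split=> // z /Fsub[z1 fz] i.
  rewrite ltNge; apply/negP => gz.
  have fx : f x <= dual_norm f.
    by apply: le_trans (ler_norm _) (le_dual_norm f _); rewrite x1.
  have := far _ _ z1 gz; rewrite linearB /=; apply/negP; rewrite -ltNge.
  by move: (f x : R) (f z : R) fx fz => a b; lra.
have [|F F1] := @exists_dual_sphere R X x; first by rewrite -normr_gt0 x1.
exists F, 1; split=> // y [y1 _] i; rewrite ltNge; apply/negP => gy.
by apply: none; exists (y, i).
Qed.

(** Every weak neighbourhood of a point of the sphere contains a slice. *)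
Lemma slice_near_abs (R : realType) (X : normedModType R) (x : X) (n : nat)
    (f : nat -> dual X) (delta : R) :
  weakMLUR X -> unit_sphere X x -> 0 < delta ->
  exists (F : dual X) (e : R), [/\ dual_sphere X F, 0 < e & forall y,
    slice F e y -> forall i, (i < n)%N -> `|f i (y - x) : R| < delta].
Proof.
move=> mlur x1 delta0.
(* each functional is used with both signs *)
pose g (p : 'I_n * bool) := scale_dual (if p.2 then 1 else -1) (f p.1).
have [F [e [F1 e0 sub]]] := slice_near g mlur x1 delta0.
exists F, e; split=> // y /sub gy i i_n.
have := gy (Ordinal i_n, true); have := gy (Ordinal i_n, false).
rewrite /= !scaleN1r !scale1r linearB ltr_norml.
by move: (f i y : R) (f i x : R) => a b h1 h2; apply/andP; split; lra.
Qed.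

(** * Weakly open sets meeting the ball contain points of the sphere *)

(** The operator [v |-> v - \sum_k f k v *: e k] maps [X] into the common
    kernel of [f 0], ..., [f n.-1]; so the [f k] determine [v] when this kernel
    is trivial. *)
Lemma coordinate_system (R : realType) (X : normedModType R) (f : nat -> dual X)
    (n : nat) : exists e : nat -> X, forall v i, (i < n)%N ->
  f i (v - \sum_(k < n) f k v *: e k) = 0.
Proof.
elim: n => [|n [e eP]]; first by exists (fun=> 0).
(* [f n w = 1] if [f n] is nonzero on the common kernel of the previous
   functionals, and [w = 0] otherwise *)
have [w [wN wn]] : exists w, (forall i, (i < n)%N -> f i w = 0) /\
    forall u, (forall i, (i < n)%N -> f i u = 0) -> f n u = f n u * f n w.
  have [[w [wN fw]]|none] :=
      pselect (exists w, (forall i, (i < n)%N -> f i w = 0) /\ f n w != 0).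
    exists ((f n w : R)^-1 *: w); split=> [i /wN|u _]; rewrite linearZ/=.
      by move=> ->; rewrite scaler0.
    by rewrite -[_ *: _]/(_ * _) mulVf// mulr1.
  exists 0; split=> [i _|u uN]; rewrite linear0 ?mulr0//.
  by apply/eqP/negPn/negP => fu; apply: none; exists u.
exists (fun k => if (k < n)%N then e k - f n (e k) *: w else w) => v i.
pose u := v - \sum_(k < n) f k v *: e k.
have -> : v - \sum_(k < n.+1) f k v *:
    (if (k < n)%N then e k - f n (e k) *: w else w) = u - (f n u : R) *: w.
  rewrite big_ord_recr/= ltnn /u linearB linear_sum/=.
  under eq_bigr => k _ do rewrite ltn_ord scalerBr scalerA.
  rewrite sumrB -scaler_suml scalerBl opprD !opprB addrA.
  rewrite sumrN -!addrA; congr (_ + _); rewrite !addrA; congr (_ - _).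
  rewrite addrC; congr (_ + _ *: _); rewrite linear_sum.
  by apply: eq_bigr => k _; rewrite linearZ.
rewrite linearB linearZ/= => i_n.
have uN : forall i, (i < n)%N -> f i u = 0 by exact: eP.
have [->|neq] := eqVneq i n; first by rewrite -[_ *: _]/(_ * _) -wn// subrr.
have {}i_n : (i < n)%N by rewrite ltn_neqAle neq -ltnS.
by rewrite (uN i)// wN// scaler0 subr0.
Qed.

Lemma sphere_point_direction (R : realType) (X : normedModType R) (x v : X) :
  `|x| <= 1 -> v != 0 -> exists t : R, `|x + t *: v| = 1.
Proof.
move=> x1 v0; have nv0 : 0 < `|v| by rewrite normr_gt0.
pose b := 2 / `|v|; have b0 : 0 <= b by rewrite divr_ge0.
have [||t _ tP] := @IVT R (fun t : R => `|x + t *: v|) 0 b 1 b0;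
  last by exists t.
- apply: continuous_subspaceT => t; apply: cvg_norm.
  by apply: cvgD; [exact: cvg_cst|apply: cvgZr_tmp; exact: cvg_id].
- rewrite scale0r addr0 ge_min x1/= le_max; apply/orP; right.
  have := lerB_normD (b *: v) x.
  rewrite [_ + x]addrC normrZ ger0_norm// /b divfK ?gt_eqF//.
  by move: `|_ + _| `|x| x1 => p q; lra.
Qed.

(** If the common kernel were trivial, a norm estimate
    [|v| <= \sum_k |f k v| |e k|] would hold, and a slice in a small weak
    neighbourhood of a unit vector would have diameter at most 1. *)
Lemma exists_common_kernel (R : realType) (X : normedModType R) (n : nat)
    (f : nat -> dual X) :
  (exists x : X, x != 0) -> weakMLUR X -> LD2P X ->
  exists2 v : X, v != 0 & forall i, (i < n)%N -> f i v = 0.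
Proof.
move=> [x0 x0_neq0] mlur ld2p; have [e eP] := coordinate_system f n.
have [[v v0]|all0] := pselect (exists v, v - \sum_(k < n) f k v *: e k != 0).
  by exists (v - \sum_(k < n) f k v *: e k) => // i; exact: eP.
exfalso; pose M := \sum_(k < n) `|e k|; have M0 : 0 <= M by exact: sumr_ge0.
(* chosen so that [2 * delta * M <= 1] *)
pose delta : R := (2 * (1 + M))^-1.
have delta0 : 0 < delta by rewrite invr_gt0 mulr_gt0// ltr_pwDl.
have x1 : unit_sphere X (`|x0|^-1 *: x0).
  rewrite /unit_sphere/= normrZ gtr0_norm ?invr_gt0 ?normr_gt0//.
  by rewrite mulVf// normr_eq0.
have [F [r [F1 r0 sub]]] := slice_near_abs n f mlur x1 delta0.
have := ld2p F r F1 r0; apply/eqP; rewrite lt_eqF//.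
apply: (@le_lt_trans _ _ 1%:E); last by rewrite lte_fin ltr1n.
apply: ge_ereal_sup => _ [y /sub yS] [z /sub zS] <-; rewrite lee_fin.
have -> : y - z = \sum_(k < n) f k (y - z) *: e k.
  apply/eqP; rewrite -subr_eq0; apply/negPn/negP => h.
  by apply: all0; exists (y - z).
apply: (@le_trans _ _ (\sum_(k < n) 2 * delta * `|e k|)).
  apply: le_trans (ler_norm_sum _ _ _) _; apply: ler_sum => k _.
  rewrite normrZ ler_wpM2r//.
  have := yS k (ltn_ord k); have := zS k (ltn_ord k); rewrite !linearB.
  move: (f k y : R) (f k z : R) (f k _ : R) => a b c.
  rewrite !ltr_norml ler_norml.
  by move=> /andP[? ?] /andP[? ?]; apply/andP; split; lra.
rewrite -mulr_sumr -/M /delta invfM mulrA divff// mul1r ler_pdivrMl ?ltr_pwDl//.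
by rewrite mulr1 lerDr.
Qed.

(** The sets containing a neighbourhood of [x] given by finitely many
    functionals form a filter that converges weakly to [x], as it does so along
    each functional. *)
Lemma weak_nbhs_basis (R : realType) (X : normedModType R) (U : set (weak X))
    (x : X) : open U -> U x ->
  exists (n : nat) (f : nat -> dual X) (delta : R), 0 < delta /\
    forall y : X, (forall i, (i < n)%N -> `|f i (y - x) : R| < delta) -> U y.
Proof.
move=> Uo Ux.
pose F : set_system X := [set A | exists (n : nat) (f : nat -> dual X)
  (delta : R), 0 < delta /\
    forall y : X, (forall i, (i < n)%N -> `|f i (y - x) : R| < delta) -> A y].
have FF : Filter F.
  split.
  - have c0 : continuous (\0 : {linear X -> R^o}) by exact: cst_continuous.
    by exists 0, (fun=> Dual c0), 1.
  - move=> A B [n1 [f1 [d1 [d10 h1]]]] [n2 [f2 [d2 [d20 h2]]]].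
    exists (n1 + n2)%N, (fun i => if (i < n1)%N then f1 i else f2 (i - n1)%N),
      (Order.min d1 d2).
    split; first by rewrite lt_min d10.
    move=> y hy; split; [apply: h1 => i i1|apply: h2 => i i2].
      by have := hy i (ltn_addr _ i1); rewrite i1 lt_min => /andP[].
    have := hy (n1 + i)%N; rewrite ltn_add2l => /(_ i2).
    by rewrite ltnNge leq_addr/= addKn lt_min => /andP[].
  - move=> A B AB [n [f [d [d0 h]]]]; exists n, f, d; split=> // y /h.
    exact: AB.
suff Fx : F --> (x : weak X) by exact: (Fx U (open_nbhs_nbhs (conj Uo Ux))).
apply/cvg_sup => h A.
rewrite nbhsE => -[_ [[V Vo <-] Vx] VA].
have : nbhs (h x : R) V by exact: open_nbhs_nbhs.
move=> /nbhs_ballP[d /= d0 dV]; exists 1, (fun=> h), d; split=> // y hy.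
apply: VA; apply: dV; rewrite -ball_normE /= distrC.
by have := hy 0 (ltn0Sn 0); rewrite linearB.
Qed.

(* The hypothesis [X_neq0] (X is not the zero space) is the usual standing
   convention: the zero space has no slices, so it is vacuously weak MLUR and
   has the LD2P, but its unit ball has diameter 0. *)
Theorem proposition1p3 (R : realType) (X : completeNormedModType R)
    (X_neq0 : exists x : X, x != 0) :
  weakMLUR X -> LD2P X -> D2P X.
Proof.
move=> mlur ld2p U Uo [x0 [x01 Ux0]].
have [n [f [delta [delta0 Usub]]]] := weak_nbhs_basis Uo Ux0.
have [v v0 fv] := exists_common_kernel n f X_neq0 mlur ld2p.
have [t xt1] := sphere_point_direction x01 v0.
have [F [e [F1 e0 Fsub]]] :=
  slice_near_abs n f mlur (xt1 : unit_sphere X _) delta0.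
have SU : slice F e `<=` unit_ball X `&` (U : set X).
  move=> y Sy; split; first exact: Sy.1.
  apply: Usub => i i_n; have := Fsub y Sy i i_n.
  by rewrite opprD addrA linearB linearZ/= fv// scaler0 subr0.
apply/le_anti/andP; split.
  apply: ge_ereal_sup => _ [y [y1 _]] [z [z1 _]] <-; rewrite lee_fin.
  by apply: le_trans (ler_normB _ _) _; rewrite -[2]/(1 + 1) lerD.
rewrite -(ld2p F e F1 e0); apply: le_ereal_sup => _ [y Sy] [z Sz] <-.
by exists y; [exact: SU|exists z => //; exact: SU].
Qed.
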